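(* For every $q\in(0,\log(\frac{1+\sqrt5}{2}))$ there exist continuum many (i.e. a set of cardinality of the continuum of) distinct $S$-gap shifts which have the specification property and entropy $q$.
   Context: For a nonempty set $S\subseteq\{0,1,2,\dots\}$, the $S$-gap shift $X(S)\subseteq\{0,1\}^{\mathbb{Z}}$ is the set of bi-infinite binary sequences in which the number of consecutive zeros between ones is always an element of $S$. The entropy of a shift $X$ is $h(X)=\lim_n\frac1n\log|\mathcal{B}_n(X)|$, where $\mathcal{B}_n(X)$ is the set of words of length $n$ occurring in points of $X$ and $\log$ is to base $2$. $X$ has the specification property if there is $N\ge1$ such that for all $u,v\in\mathcal{B}(X)=\bigcup_n\mathcal{B}_n(X)$ there exists $w\in\mathcal{B}_N(X)$ with $uwv\in\mathcal{B}(X)$. *)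

(* Defs.v *)
From HB Require Import structures.
From mathcomp Require Import all_boot all_order all_algebra.
From mathcomp Require Import all_classical all_reals all_analysis.
Set Implicit Arguments. Unset Strict Implicit. Unset Printing Implicit Defensive.
Import Order.TTheory GRing.Theory Num.Theory.
Import numFieldNormedType.Exports.
Local Open Scope classical_set_scope.
Local Open Scope ring_scope.

(* Bi-infinite binary sequences: int -> bool (true = symbol 1). *)
Definition bseq := int -> bool.

Definition gap_shift (S : set nat) : set bseq :=
  [set x : bseq | forall i j : int, i < j -> x i -> x j ->
           (forall k : int, i < k < j -> ~~ x k) -> S (absz (j - i - 1)%R)].

Definition occurs (x : bseq) (w : seq bool) : Prop :=
  exists i : int, forall k : nat, (k < size w)%N -> x (i + k%:Z) = nth false w k.

Definition lang (X : set bseq) : set (seq bool) :=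
  [set w | exists x, X x /\ occurs x w].

Definition Bn (X : set bseq) (n : nat) : {set n.-tuple bool} :=
  [set t : n.-tuple bool | `[< lang X (tval t) >] ].

Definition has_entropy (R : realType) (X : set bseq) (q : R) : Prop :=
  ((fun n : nat => ln (#|Bn X n|%:R : R) / (ln 2 * n%:R)) : nat -> R) @ \oo --> q.

Definition specification (X : set bseq) : Prop :=
  exists N : nat, (1 <= N)%N /\
    forall u v, lang X u -> lang X v ->
      exists w, size w = N /\ lang X w /\ lang X (u ++ w ++ v).

(* Main.v *)
Require Import Defs.
From mathcomp Require Import all_boot all_order all_algebra.
From mathcomp Require Import all_classical all_reals all_analysis.
From mathcomp Require Import zify ring lra.
Import Order.TTheory GRing.Theory Num.Theory.
Import numFieldNormedType.Exports.
Local Open Scope classical_set_scope.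
Local Open Scope ring_scope.

(** Put [x = 2^-q], so that [1 < x + x^2] by the assumption on [q]. If
    [\sum_(k in S) x^(k+1) = 1], the rescaled tails
    [phi k = \sum_(j >= k, j in S) x^(j-k+1)] satisfy
    [phi k = x phi (k+1) + [k in S] x], which is exactly the recursion obeyed by
    [x^n] times the number of admissible continuations of length [n] of a word
    ending in [1 0^k]. If [phi] is bounded away from [0], the number of words of
    length [n] is hence [x^-n] up to constant factors and the entropy is [q].
    A syndetic [S] for which [S + 1] contains two coprime numbers gives
    specification. Since [x + x^2 > 1], one may prescribe which multiples of a
    large prime [M] lie in [S + 1] and still complete the sum to [1] greedily
    with non-multiples of [M]: odd multiples are always taken, and the even
    ones encode an arbitrary Dedekind cut. *)

(** * Words of a gap shift as runs of an automaton *)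

(* A state is the number of zeros read since the last one, or [None] if no one
   has been read yet. *)
Definition one_allowed (S : set nat) (s : option nat) : bool :=
  if s is Some k then `[< S k >] else true.

Definition next_state (s : option nat) (b : bool) : option nat :=
  if b then Some 0%N else omap succn s.

Fixpoint accepts (S : set nat) (s : option nat) (w : seq bool) : bool :=
  if w is b :: w' then
    (b ==> one_allowed S s) && accepts S (next_state s b) w'
  else true.

Definition final_state (s : option nat) (w : seq bool) : option nat :=
  foldl next_state s w.

Lemma accepts_cat S s u v :
  accepts S s (u ++ v) = accepts S s u && accepts S (final_state s u) v.
Proof. by elim: u s => //= b u IH s; rewrite IH andbA. Qed.

Lemma final_state_cat s u v :
  final_state s (u ++ v) = final_state (final_state s u) v.
Proof. exact: foldl_cat. Qed.

Lemma accepts_zeros S s c : accepts S s (nseq c false).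
Proof. by elim: c s => //= c IH s. Qed.

Lemma final_state_zeros s c : final_state s (nseq c false) = omap (addn c) s.
Proof.
elim: c s => [|c IH] [k|] //; last exact: IH.
by rewrite [LHS]IH /= addnS.
Qed.

(** Forgetting the past only lifts the constraint on the first one of [w]. *)
Lemma accepts_none S s w : accepts S s w -> accepts S None w.
Proof.
elim: w s => //= -[] w IH s /=; first by case/andP.
exact: IH.
Qed.

Lemma accepts_nth_gap S k w b : accepts S (Some k) w -> nth false w b ->
  (forall c, (c < b)%N -> ~~ nth false w c) -> S (k + b)%N.
Proof.
elim: w k b => [|d w IH] k b //=; first by rewrite nth_nil.
case: b => [|b] /andP[h1 h2].
  by move=> /= dT _; move: h1; rewrite dT addn0 => /asboolP.
move=> /= wb hc; have := hc 0%N isT; case: d h1 h2 hc => //= _ h2 hc _.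
rewrite addnS -addSn; apply: IH => // c cb.
exact: (hc c.+1).
Qed.

Lemma accepts_nth S s w a b : accepts S s w -> (a < b)%N ->
  nth false w a -> nth false w b ->
  (forall c, (a < c < b)%N -> ~~ nth false w c) -> S (b - a).-1.
Proof.
elim: w s a b => [|d w IH] s a b /=; first by rewrite nth_nil.
case: b => // b /andP[_ h2]; case: a => [|a] ab /=.
  move=> dT wb hc; rewrite dT /= in h2.
  rewrite -[X in S X]add0n; apply: accepts_nth_gap h2 wb _ => c cb.
  exact: (hc c.+1).
move=> wa wb hc; rewrite subSS; apply: IH h2 _ wa wb _ => // c hcc.
exact: (hc c.+1).
Qed.

(** The condition on [s] is the invariant of the run: in state [Some k] the last one of [x] before
    [i] sits at [i - k - 1], and [None] claims nothing. *)
Lemma accepts_occurs S x s w i : gap_shift S x ->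
  (forall k, s = Some k -> x (i - k%:Z - 1) /\
     forall j : int, i - k%:Z - 1 < j < i -> ~~ x j) ->
  (forall k : nat, (k < size w)%N -> x (i + k%:Z) = nth false w k) ->
  accepts S s w.
Proof.
move=> Sx; elim: w s i => //= b w IH s i hs hw; apply/andP; split.
  apply/implyP => bT; case: s hs => //= k /(_ k erefl)[xk hk].
  apply/asboolP; have -> : k = absz (i - (i - k%:Z - 1) - 1)%R by lia.
  apply: Sx => //; first by lia.
  by have := hw 0%N isT; rewrite addr0 bT => ->.
apply: (IH _ (i + 1)) => [k|k kw]; last first.
  by have := hw k.+1 kw; rewrite /= => <-; congr x; lia.
have xi := hw 0%N isT; rewrite addr0 /= in xi.
case: b xi {hw} => /= xi.
  case=> <-; have -> : i + 1 - 0%:Z - 1 = i by lia.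
  by rewrite xi; split => // j hj; lia.
case: s hs => //= k' /(_ k' erefl)[xk hk] [<-].
have -> : i + 1 - k'.+1%:Z - 1 = i - k'%:Z - 1 by lia.
split=> // j hj; have [->|ji] := eqVneq j i; first by rewrite xi.
by apply: hk; lia.
Qed.

Lemma langE S w : lang (gap_shift S) w <-> accepts S None w.
Proof.
split=> [[x [Sx [i hi]]]|Sw]; first exact: (accepts_occurs _ x _ _ i).
(* Infinite runs of zeros are unconstrained, so [w] may be padded with zeros on both sides. *)
exists (fun i => if i is Posz n then nth false w n else false); split; last first.
  by exists 0 => k kw; rewrite add0r.
move=> [a|a] [b|b] //= ab xa xb hab.
have -> : absz (b%:Z - a%:Z - 1)%R = (b - a).-1 by lia.
apply: accepts_nth Sw _ xa xb _ => [|c hc]; first by lia.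
by apply: (hab (Posz c)); lia.
Qed.

(** The words [1 0^k 1] in the language recover [S]. *)
Lemma gap_shift_inj S S' : gap_shift S = gap_shift S' -> S = S'.
Proof.
have E U k : lang (gap_shift U) (true :: nseq k false ++ [:: true]) <-> U k.
  rewrite langE /= accepts_cat accepts_zeros final_state_zeros /= addn0 andbT.
  by split=> /asboolP.
by move=> h; apply/seteqP; split=> k /E Sk; apply/E; [rewrite -h|rewrite h].
Qed.

(** * Specification *)

Lemma coprime_span a b m : coprime a b -> (0 < a)%N -> (0 < b)%N ->
  (a * b <= m)%N -> exists i j, m = (i * a + j * b)%N.
Proof.
move=> cab a0 b0 abm.
(* The remainder gives [j * b = m] modulo [a]; reducing [j] below [a] keeps
   [j * b <= a * b <= m]. *)
pose j := (chinese a b m 0 %/ b %% a)%N.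
have bj : (j * b = m %[mod a])%N.
  rewrite /j modnMml divnK ?chinese_modl //.
  by rewrite /dvdn chinese_modr // mod0n.
have jm : (j * b <= m)%N.
  by apply: leq_trans abm; rewrite leq_mul2r ltnW ?orbT // ltn_mod.
exists ((m - j * b) %/ a)%N, j; rewrite divnK ?subnK //.
by rewrite -eqn_mod_dvd //; apply/eqP.
Qed.

(** The blocks [0^a 1] and [0^b 1] are loops at state [Some 0] of coprime lengths, so their
    concatenations realise every large length. *)
Lemma return_words S a b m : S a -> S b -> coprime a.+1 b.+1 ->
  (a.+1 * b.+1 <= m)%N ->
  exists w, [/\ size w = m, accepts S (Some 0%N) w
              & final_state (Some 0%N) w = Some 0%N].
Proof.
move=> Sa Sb cab /(coprime_span _ _ _ cab isT isT)[i [j ->]].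
have pow c n : S c -> exists w, [/\ size w = (n * c.+1)%N,
    accepts S (Some 0%N) w & final_state (Some 0%N) w = Some 0%N].
  move=> Sc; elim: n => [|n [w [sw aw fw]]]; first by exists [::].
  exists (nseq c false ++ true :: w).
  rewrite size_cat size_nseq /= accepts_cat accepts_zeros final_state_zeros.
  rewrite final_state_cat final_state_zeros /= addn0 aw.
  by split=> //; [rewrite sw; lia|rewrite andbT; apply/asboolP].
have [u [su au fu]] := pow a i Sa; have [v [sv av fv]] := pow b j Sb.
exists (u ++ v); rewrite size_cat su sv accepts_cat final_state_cat fu au av.
by split.
Qed.

Lemma gap_shift_specification S L a b :
  (forall k, exists2 c, (c <= L)%N & S (k + c)%N) ->
  S a -> S b -> coprime a.+1 b.+1 -> specification (gap_shift S).
Proof.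
move=> synS Sa Sb cab.
have close v k : accepts S None v ->
    exists2 c, (c <= L)%N & accepts S (Some (k + c)%N) v.
  elim: v k => [|[] v IH] k /=; first by exists 0%N.
    have [c cL Sc] := synS k; exists c => //.
    by rewrite H andbT; apply/asboolP.
  by move=> /(IH k.+1)[c cL]; exists c.
have fit s : exists2 c, (c <= L)%N & one_allowed S (omap (addn c) s).
  case: s => [k|]; last by exists 0%N.
  have [c cL Sc] := synS k; exists c => //=.
  by rewrite addnC; apply/asboolP.
(* The connecting word is [0^c 1 w 0^d]: [c] zeros make a one legal after [u], [d] zeros make [v]
   legal. The loop [w] absorbs the variation of [c] and [d], both at most [L], so the total length
   is fixed. *)
exists (a.+1 * b.+1 + 2 * L + 1)%N; split; first by rewrite addn1.
move=> u v /langE Su /langE Sv.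
have [c cL Sc] := fit (final_state None u).
have [d dL] := close v 0%N Sv; rewrite add0n => Sd.
have [|w [sw Sw fw]] :=
  return_words _ _ _ (a.+1 * b.+1 + (2 * L - c - d))%N Sa Sb cab.
  exact: leq_addr.
pose m := nseq c false ++ true :: w ++ nseq d false.
have Sm : accepts S None (u ++ m ++ v).
  rewrite accepts_cat Su /= /m -catA accepts_cat accepts_zeros.
  rewrite final_state_zeros /= Sc /= -catA accepts_cat Sw fw.
  by rewrite accepts_cat accepts_zeros final_state_zeros /= addn0.
exists m; split; first by rewrite /m size_cat /= size_cat !size_nseq sw; lia.
split; apply/langE => //; move: Sm; rewrite accepts_cat => /andP[_].
rewrite accepts_cat => /andP[+ _]; exact: accepts_none.
Qed.

(** * Counting words and entropy *)

Definition accepted (S : set nat) (s : option nat) (n : nat) :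
  {set n.-tuple bool} := [set t : n.-tuple bool | accepts S s t]%SET.

Lemma card_accepted0 S s : #|accepted S s 0| = 1%N.
Proof.
suff -> : accepted S s 0 = [set [tuple]]%SET by rewrite cards1.
by apply/setP => t; rewrite (tuple0 t) !inE eqxx.
Qed.

Lemma card_acceptedS S s n : #|accepted S s n.+1| =
  (#|accepted S (omap succn s) n| + one_allowed S s * #|accepted S (Some 0) n|)%N.
Proof.
have E b : #|accepted S s n.+1 :&: [set t | thead t == b]%SET|
         = #|[set t : n.-tuple bool | accepts S s (b :: t)]%SET|.
  have cons_inj : injective (fun t : n.-tuple bool => [tuple of b :: t]).
    by move=> t t' [] h; apply/val_inj.
  rewrite -(card_imset _ cons_inj); apply: eq_card => t; rewrite !inE.
  apply/andP/imsetP => [[St /eqP tb]|[t' + ->]]; last by rewrite inE.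
  exists [tuple of behead t]; last by rewrite -tb [LHS]tuple_eta.
  by move: St; rewrite inE [in X in X -> _](tuple_eta t) tb.
rewrite -(cardsID [set t | thead t == false]%SET) E; congr (_ + _)%N.
have -> : (one_allowed S s * #|accepted S (Some 0) n|)%N =
    #|[set t : n.-tuple bool | accepts S s (true :: t)]%SET|.
  case: (boolP (one_allowed S s)) => h; rewrite ?mul1n ?mul0n.
    by apply: eq_card => t; rewrite !inE /= h.
  by apply/esym/eqP; rewrite cards_eq0; apply/eqP/setP => t;
    rewrite !inE /= (negbTE h).
by rewrite -E; apply: eq_card => t; rewrite !inE andbC; case: (thead t).
Qed.

(* At [None] the value is forced by harmonicity: it solves [p = x p + x]. *)
Definition potential (R : realType) (x : R) (phi : nat -> R) (s : option nat) : R :=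
  if s is Some k then phi k else x / (1 - x).

(** The potential and [x^n] times the count obey the same recursion with nonnegative coefficients,
    so the comparison at [n = 0], where the count is 1, propagates. Reading a one leads to [Some 0],
    where [phi 0 = 1] normalises the potential. *)
Lemma card_accepted_bounds (R : realType) (S : set nat) (x kap : R)
    (phi : nat -> R) (s : option nat) (n : nat) :
  0 < x < 1 -> phi 0%N = 1 ->
  (forall k, phi k = x * phi k.+1 + (`[< S k >])%:R * x) ->
  (forall k, kap <= phi k <= x / (1 - x)) ->
  kap * (x ^+ n * #|accepted S s n|%:R) <= potential R x phi s
    <= x / (1 - x) * (x ^+ n * #|accepted S s n|%:R).
Proof.
move=> /andP[x0 x1] phi0 phiS phib.
have harmonic u : potential R x phi u =
    x * potential R x phi (omap succn u) + (one_allowed S u)%:R * x.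
  case: u => [k|] //=; field; lra.
elim: n s => [|n IH] s.
  rewrite card_accepted0 mul1r !mulr1; case: s => [k|] //=.
  by rewrite lexx andbT; have /andP[] := phib 0%N; apply: le_trans.
rewrite card_acceptedS natrD natrM harmonic.
have /andP[l1 u1] := IH (omap succn s); have := IH (Some 0%N).
rewrite /= phi0 exprS => /andP[l2 u2].
have b0 : 0 <= (one_allowed S s)%:R * x :> R by rewrite mulr_ge0 ?ler0n ?ltW.
have L1 := ler_wpM2l (ltW x0) l1; have U1 := ler_wpM2l (ltW x0) u1.
have L2 := ler_wpM2l b0 l2; have U2 := ler_wpM2l b0 u2.
rewrite mulr1 in L2 U2; apply/andP; split.
  by apply: le_trans (lerD L1 L2); rewrite le_eqVlt; apply/orP; left; apply/eqP; ring.
by apply: (le_trans (lerD U1 U2)); rewrite le_eqVlt; apply/orP; left; apply/eqP; ring.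
Qed.

Lemma BnE S n : Bn (gap_shift S) n = accepted S None n.
Proof. by apply/setP => t; rewrite !inE; apply/asboolP/idP => /langE. Qed.

Lemma gap_shift_entropy (R : realType) (S : set nat) (x kap : R)
    (phi : nat -> R) :
  0 < x < 1 -> 0 < kap -> phi 0%N = 1 ->
  (forall k, phi k = x * phi k.+1 + (`[< S k >])%:R * x) ->
  (forall k, kap <= phi k <= x / (1 - x)) ->
  has_entropy (gap_shift S) (- ln x / ln 2).
Proof.
move=> x01 kap0 phi0 phiS phib; have /andP[x0 x1] := x01.
have I0 : 0 < x / (1 - x) by rewrite divr_gt0 // subr_gt0.
have ln20 : 0 < ln 2 :> R by rewrite ln_gt0 // ltr1n.
pose C := ln (x / (1 - x) / kap).
have bnd n : (0 < n)%N -> - ln x / ln 2 <=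
    ln (#|Bn (gap_shift S) n|%:R : R) / (ln 2 * n%:R) <=
    - ln x / ln 2 + C / ln 2 * n%:R^-1.
  move=> n0; have n0' : 0 < n%:R :> R by rewrite ltr0n.
  have := card_accepted_bounds R S x kap phi None n x01 phi0 phiS phib.
  rewrite BnE; set N : R := #|_|%:R => /= /andP[u l].
  have l1 : 1 <= x ^+ n * N by rewrite -(ler_pM2l I0) mulr1.
  have u1 : x ^+ n * N <= x / (1 - x) / kap by rewrite ler_pdivlMr // mulrC.
  have xn0 : 0 < x ^+ n by rewrite exprn_gt0.
  have N0 : 0 < N by rewrite -(pmulr_rgt0 _ xn0); apply: lt_le_trans l1.
  (* Since [1 <= x^n N <= expR C], the logarithm of [N] exceeds [- n ln x] by an amount between 0
     and the constant [C]. *)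
  have lnE : ln (x ^+ n * N) = n%:R * ln x + ln N.
    by rewrite lnM ?posrE // lnXn // mulr_natl.
  have : 0 <= ln (x ^+ n * N) by rewrite ln_ge0.
  have : ln (x ^+ n * N) <= C.
    rewrite /C ler_ln ?posrE //; first exact: lt_le_trans l1.
    exact: divr_gt0.
  rewrite lnE => h1 h2; apply/andP; split.
    rewrite ler_pdivlMr ?mulr_gt0 // mulrA divfK ?gt_eqF //; lra.
  rewrite ler_pdivrMr ?mulr_gt0 //.
  rewrite [leRHS](_ : _ = - ln x * n%:R + C); first by lra.
  by field; rewrite !gt_eqF.
rewrite /has_entropy.
apply: (@squeeze_cvgr _ _ _ _ (fun=> - ln x / ln 2)
  (fun n => - ln x / ln 2 + C / ln 2 * n%:R^-1)).
- by near=> n; apply: bnd; near: n; exists 1%N.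
- exact: cvg_cst.
- rewrite -[X in _ --> X]addr0; apply: cvgD; first exact: cvg_cst.
  rewrite -[X in _ --> X](mulr0 (C / ln 2)); apply: cvgM; first exact: cvg_cst.
  apply/gtr0_cvgV0; last exact: cvgr_idn.
  by near=> n; rewrite ltr0n; near: n; exists 1%N.
Unshelve. all: by end_near. Qed.

(** * Discounted sums and greedy expansions *)

(** [e k] is the series [\sum_(j >= k) d j x^(j-k+1)], obtained as the limit of its truncations
    [psum n k], which increase with [n] and stay below the supersolution [mu]. *)
Lemma discounted_sum (R : realType) (x : R) (d : nat -> bool) (mu : nat -> R) :
  0 < x -> (forall k, 0 <= mu k) ->
  (forall k, x * mu k.+1 + (d k)%:R * x <= mu k) ->
  exists e : nat -> R, (forall k, e k = x * e k.+1 + (d k)%:R * x) /\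
                       (forall k, 0 <= e k <= mu k).
Proof.
move=> x0 mu0 muS.
pose psum := fix psum n k : R :=
  if n is n'.+1 then x * psum n' k.+1 + (d k)%:R * x else 0.
have dx0 k : 0 <= (d k)%:R * x by rewrite mulr_ge0 ?ler0n ?(ltW x0).
have psum0 n k : 0 <= psum n k.
  by elim: n k => //= n IH k; rewrite addr_ge0 // mulr_ge0 ?(ltW x0).
have psum_mu n k : psum n k <= mu k.
  elim: n k => //= n IH k; apply: le_trans (muS k).
  by rewrite lerD2r ler_wpM2l ?(ltW x0).
have psumS n k : psum n k <= psum n.+1 k.
  elim: n k => [|n IH] k; first by rewrite /= mulr0 add0r.
  by rewrite [leLHS]/= [leRHS]/= lerD2r ler_wpM2l ?(ltW x0).
have psum_cvg k : cvgn (psum^~ k).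
  apply: nondecreasing_is_cvgn.
    by apply/nondecreasing_seqP => n; exact: psumS.
  by exists (mu k) => _ [n _ <-].
exists (fun k => limn (psum^~ k)); split=> k; last first.
  by apply/andP; split; [apply: limr_ge|apply: limr_le] => //; exact: nearW.
apply/cvg_lim => //; rewrite -(cvg_shiftS (psum^~ k)) /=.
apply: cvgD; last exact: cvg_cst.
by apply: cvgM; [exact: cvg_cst|exact: psum_cvg].
Qed.

Lemma expr_eventually_lt (R : realType) (x eps : R) : 0 < x < 1 -> 0 < eps ->
  exists n, forall m, (n <= m)%N -> x ^+ m < eps.
Proof.
move=> /andP[x0 x1] eps0.
have : `|x| < 1 by rewrite gtr0_norm.
move=> /cvg_expr /cvgr0Pnorm_lt /(_ _ eps0) [n _ hn]; exists n => m nm.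
by have := hn m nm; rewrite /= ger0_norm // exprn_ge0 // ltW.
Qed.

(* [h k] is the rescaled sum of all terms still available from position [k] on;
   [F k -> 1 <= h k.+1] is Kakeya's condition that no available term exceeds the
   sum of the later ones, so that the greedy choice never gets stuck. *)
Lemma greedy_expansion (R : realType) (x z0 B : R) (F : pred nat) (h : nat -> R) :
  0 < x < 1 -> 0 < z0 <= h 0%N ->
  (forall k, h k = x * h k.+1 + (F k)%:R * x) ->
  (forall k, h k <= B) -> (forall k, F k -> 1 <= h k.+1) ->
  exists (z : nat -> R) (g : pred nat), z 0%N = z0 /\
    [/\ forall k, z k = x * z k.+1 + (g k)%:R * x,
        forall k, 0 <= z k <= h k, subpred g F & exists k, g k].
Proof.
move=> x01 /andP[z0_gt0 z0h] hS hB hF; have /andP[x0 x1] := x01.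
(* [z k] is what remains to be represented before position [k], rescaled by [x^-k]; an available [k]
   is taken as soon as its term [x] fits. *)
pose z := fix z k : R :=
  if k is k'.+1 then z k' / x - (F k' && (x <= z k'))%:R else z0.
pose g k := F k && (x <= z k).
have zS k : z k = x * z k.+1 + (g k)%:R * x.
  by rewrite /= -/(g k); field; rewrite gt_eqF.
have zb k : 0 <= z k <= h k.
  elim: k => [|k /andP[zk0 zkh]]; first by rewrite /= z0h ltW.
  suff: 0 <= x * z k.+1 <= x * h k.+1 by rewrite pmulr_rge0 // ler_pM2l.
  have := zS k; have := hS k; have := hF k.
  move: (z k.+1) (h k.+1) => zk' hk'; rewrite /g; case: (F k) => /= hFk hk; last first.
    rewrite !mul0r !addr0 in hk * => zk.
    by rewrite -zk -hk zk0.
  (* If [k] is taken, both [z k] and [h k] lose [x]; if it is skipped, [z k < x <= x h k.+1] by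
     Kakeya's condition. *)
  have := ler_wpM2l (ltW x0) (hFk isT).
  by case: (leP x (z k)) => /= xz ? zk; apply/andP; split; lra.
exists z, g; split => //; split=> //; first by move=> k /andP[].
apply: contrapT => nog.
(* If nothing were ever taken, [z0 = x^n z n <= x^n B] would tend to 0. *)
have zX n : z0 = x ^+ n * z n.
  elim: n => [|n ->]; first by rewrite mul1r.
  rewrite exprSr -mulrA; congr (_ * _); rewrite [LHS]zS.
  case: (boolP (g n)) => [gn|_]; first by case: nog; exists n.
  by rewrite mul0r addr0.
have B0 : 0 < B by apply: lt_le_trans z0_gt0 (le_trans z0h _).
have [n /(_ n (leqnn n))] := expr_eventually_lt R x (z0 / B) x01 (divr_gt0 z0_gt0 B0).
rewrite ltr_pdivlMr //; apply/negP; rewrite -leNgt {1}(zX n).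
rewrite ler_wpM2l ?exprn_ge0 ?(ltW x0) //.
by have /andP[_ /le_trans] := zb n; apply.
Qed.

(** * Weight and spacing of the multiples of [M] *)

(** The fraction is the geometric series of all [x^(j-k+1)] with [j >= k] and [M] dividing [j+1];
    the first such [j+1] lies [M - k %% M] beyond [k]. *)
Lemma multiples_potential (R : realType) (x : R) (M k : nat) :
  0 < x < 1 -> (0 < M)%N ->
  x ^+ (M - k %% M) / (1 - x ^+ M) =
  x * (x ^+ (M - k.+1 %% M) / (1 - x ^+ M)) + (M %| k.+1)%:R * x.
Proof.
move=> /andP[x0 x1] M0.
have xM : 1 - x ^+ M != 0 by rewrite subr_eq0 gt_eqF // exprn_ilt1 ?(ltW x0) // -lt0n.
have kM : (k %% M < M)%N by rewrite ltn_mod.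
have E : (k.+1 = (k %% M).+1 %[mod M])%N by rewrite -addn1 -modnDml addn1.
rewrite /dvdn E; have [lt|ge] := ltnP (k %% M).+1 M.
  rewrite (modn_small lt) /= mul0r addr0 mulrA -exprS; congr (x ^+ _ / _); lia.
have -> : (k %% M).+1 = M by lia.
rewrite modnn eqxx subn0 (_ : (M - k %% M)%N = 1%N) ?expr1; last by lia.
by move: (x ^+ M) xM => y xM /=; field.
Qed.

Lemma odd_multiple_within M k : (0 < M)%N ->
  exists2 c, (c <= 3 * M)%N & exists i, (k + c = (i.*2.+1 * M).-1)%N.
Proof.
move=> M0; have kE := divn_eq k M.*2.
have kM : (k %% M.*2 < M.*2)%N by rewrite ltn_mod double_gt0.
(* The odd multiple in the block of length [2M] following that of [k] exceeds [k] in every case. *)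
pose i := (k %/ M.*2).+1.
have iM : (i.*2.+1 * M = (k %/ M.*2) * M.*2 + 3 * M)%N by rewrite /i; nia.
exists ((i.*2.+1 * M).-1 - k)%N; first by lia.
by exists i; rewrite subnKC //; lia.
Qed.

(** The single gap [k + c] already contributes [x^(c+1)]. *)
Lemma potential_ge_power (R : realType) (x : R) (S : set nat) (phi : nat -> R)
    (L k : nat) : 0 < x < 1 ->
  (forall k, phi k = x * phi k.+1 + (`[< S k >])%:R * x) ->
  (forall k, 0 <= phi k) ->
  (exists2 c, (c <= L)%N & S (k + c)%N) -> x ^+ L.+1 <= phi k.
Proof.
move=> /andP[x0 x1] phiS phi0 [c cL Sc].
apply: (@le_trans _ _ (x ^+ c.+1)).
  by apply: ler_wiXn2l; rewrite ?ltW.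
elim: c k Sc {cL} => [|c IH] k Sc.
  rewrite addn0 in Sc; rewrite expr1 phiS asboolT // mul1r lerDr.
  by rewrite mulr_ge0 // ltW.
rewrite addnS -addSn in Sc; rewrite phiS exprS.
apply: (@le_trans _ _ (x * phi k.+1)); first by rewrite ler_pM2l ?IH.
by rewrite lerDl mulr_ge0 ?ler0n // ltW.
Qed.

(** * Encoding a subset of [nat] in a gap set *)

(* Positions [k] are shifted by one against exponents: a gap [k] contributes
   [x ^+ k.+1]. Odd multiples of the prime [M] make [S] syndetic, even multiples
   encode [D], and the greedy expansion over the non-multiples of [M] fills up
   the sum; it picks at least one exponent, which is then coprime to [M]. *)
Lemma gap_set_encoding (R : realType) (x : R) : 0 < x < 1 -> 1 < x + x ^+ 2 ->
  exists c : nat -> nat, forall D : pred nat, exists S : set nat,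
    [/\ forall j, S (c j) <-> D j, S !=set0, specification (gap_shift S)
      & has_entropy (gap_shift S) (- ln x / ln 2)].
Proof.
move=> x01 hx; have /andP[x0 x1] := x01.
pose I := x / (1 - x).
have IE : I * (1 - x) = x by rewrite /I divfK // subr_eq0 gt_eqF.
(* [I] is the sum of all [x^(j+1)]. Multiplied by [1 - x], this inequality is exactly
   [1 < x + x^2]. *)
have I1x : x < I - 1.
  by rewrite ltrBrDr /I ltr_pdivlMr ?subr_gt0 //; lra.
(* The first bound makes the multiples of [M] sum to less than 1; the second bounds their rescaled
   tails by [I - 1], which is Kakeya's condition for the non-multiples. *)
have [M prM [M12 hM]] : exists2 M, prime M &
    x ^+ M < 2^-1 /\ x / (1 - x ^+ M) <= I - 1.
  have eps0 : 0 < 1 - x / (I - 1) by rewrite subr_gt0 ltr_pdivrMr; lra.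
  have [n1 h1] := expr_eventually_lt R x 2^-1 x01 ltac:(lra).
  have [n2 h2] := expr_eventually_lt R x _ x01 eps0.
  have [M nM prM] := prime_above (n1 + n2).
  have M1 : x ^+ M < 2^-1 by apply: h1; lia.
  exists M => //; split => //.
  have : x ^+ M < 1 - x / (I - 1) by apply: h2; lia.
  rewrite ltrBrDr -ltrBrDl ltr_pdivrMr; last by lra.
  by rewrite ler_pdivrMr; [move/ltW; rewrite mulrC|lra].
have M0 := prime_gt0 prM.
have xM0 : 0 < x ^+ M by rewrite exprn_gt0.
have xM1 : 0 < 1 - x ^+ M by lra.
pose mu k := x ^+ (M - k %% M) / (1 - x ^+ M).
have muS k : mu k = x * mu k.+1 + (M %| k.+1)%:R * x.
  exact: multiples_potential.
have mu_ge0 k : 0 <= mu k by rewrite divr_ge0 ?exprn_ge0 ?ltW.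
have mu_le k : mu k <= I - 1.
  apply: le_trans hM; rewrite ler_pM2r ?invr_gt0 //.
  rewrite -[leRHS]expr1; apply: ler_wiXn2l; rewrite ?ltW // subn_gt0.
  exact: ltn_pmod.
have mu0 : mu 0%N < 1.
  by rewrite /mu mod0n subn0 ltr_pdivrMr //; lra.
exists (fun j => ((j.+1).*2 * M).-1) => D.
(* For [k.+1 = 2(j+1)M] the argument of [D] is [j], matching the position chosen for [c j]. *)
pose d k := (M %| k.+1)%N &&
  (odd (k.+1 %/ M) || D (k.+1 %/ M)./2.-1).
have [k|e [eS eb]] := discounted_sum R x d mu x0 mu_ge0.
  rewrite [leRHS]muS lerD2l ler_pM2r // ler_nat /d.
  by case: (M %| k.+1)%N => //; exact: leq_b1.
have /andP[e0 e1] := eb 0%N.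
have hS k : I - mu k = x * (I - mu k.+1) + (~~ (M %| k.+1)%N)%:R * x.
  by rewrite muS; case: (M %| k.+1)%N => /=; lra.
(* The non-multiples must supply what the encoded multiples leave of 1; their full tails are
   [I - mu k]. *)
have [||k|k _|z [g [z0 [zS zb gF [t gt]]]]] :=
    greedy_expansion R x (1 - e 0%N) I (fun k => ~~ (M %| k.+1)%N)
      (fun k => I - mu k) x01.
- by apply/andP; split; have := mu_le 0%N; lra.
- exact: hS.
- by have := mu_ge0 k; lra.
- by have := mu_le k.+1; lra.
pose S : set nat := [set k | d k || g k].
(* The two parts are disjoint, as [g] selects only non-multiples of [M], so their indicators add. *)
have dgS k : (`[< S k >])%:R = (d k)%:R + (g k)%:R :> R.
  have -> : `[< S k >] = d k || g k by apply/asboolP/idP.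
  have := gF k; rewrite /d; case: (g k); last by rewrite orbF addr0.
  by move=> /(_ isT) /negbTE ->; rewrite add0r.
pose phi k := e k + z k.
have phi0 : phi 0%N = 1 by rewrite /phi z0; lra.
have phiS k : phi k = x * phi k.+1 + (`[< S k >])%:R * x.
  by rewrite dgS /phi eS zS; ring.
have phi_ge0 k : 0 <= phi k.
  by have /andP[? _] := eb k; have /andP[? _] := zb k; rewrite addr_ge0.
have phi_leI k : phi k <= I.
  by have /andP[_ ?] := eb k; have /andP[_ ?] := zb k; rewrite /phi; lra.
have S_odd i : S ((i.*2.+1 * M).-1).
  rewrite /S /= /d prednK ?muln_gt0 ?M0 //.
  by rewrite dvdn_mull // mulnK //= odd_double.
have synS k : exists2 c, (c <= 3 * M)%N & S (k + c)%N.
  have [c cM [i kc]] := odd_multiple_within M k M0.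
  by exists c => //; rewrite kc.
exists S; split.
- move=> j; rewrite /S /=; set k := (_ * M).-1.
  have kE : k.+1 = (j.+1.*2 * M)%N by rewrite prednK // muln_gt0 M0.
  have Mk : (M %| k.+1)%N by rewrite kE dvdn_mull.
  have gk : g k = false by apply/negP => /gF; rewrite Mk.
  by rewrite gk orbF /d Mk kE mulnK //= odd_double doubleK.
- by exists (1 * M).-1; exact: (S_odd 0%N).
- apply: (gap_shift_specification S (3 * M) (1 * M).-1 t synS).
  + exact: (S_odd 0%N).
  + by rewrite /S /= gt orbT.
  + by rewrite mul1n prednK // prime_coprime //; exact: gF.
- apply: (gap_shift_entropy R S x (x ^+ (3 * M).+1) phi) => //.
    by rewrite exprn_gt0.
  by move=> k; rewrite phi_leI andbT (potential_ge_power R x S).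
Qed.

(** * Continuum many gap sets for a given entropy *)

(** A rational strictly between two reals separates their cuts, read here along the [pickle] codes
    of the rationals; indices that code no rational give [false]. *)
Lemma dedekind_cut_inj (R : realType) (r s : R) :
  (forall n : nat, (if unpickle n is Some p then ratr (p : rat) < r else false) =
                   (if unpickle n is Some p then ratr (p : rat) < s else false)) ->
  r = s.
Proof.
move=> h; wlog rs : r s h / r < s.
  by move=> W; case: (ltgtP r s) => // /W ->.
have [p] := rat_in_itvoo rs; rewrite in_itv /= => /andP[rp ps].
by have := h (pickle p); rewrite pickleK ps ltNge (ltW rp).
Qed.

(** The inverse golden ratio is the positive root of [x + x^2 = 1], and the hypothesis places [x]
    above it. *)
Lemma golden_ratio_bound (R : realType) (x : R) :
  0 < x -> - ln x < ln ((1 + Num.sqrt 5) / 2) -> 1 < x + x ^+ 2.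
Proof.
move=> x0; set y := Num.sqrt 5 => h.
have y0 : 0 <= y by exact: sqrtr_ge0.
have yy : y ^+ 2 = 5 by rewrite sqr_sqrtr.
have phi0 : 0 < (1 + y) / 2 by lra.
have : 1 < x * ((1 + y) / 2).
  have := mulr_gt0 x0 phi0; set w := _ * _ => w0.
  suff : ln 1 < ln w by rewrite ltr_ln ?posrE.
  by rewrite ln1 lnM ?posrE //; lra.
nra.
Qed.

Theorem theorem4p3 (R : realType) (q : R) :
  0 < q < ln ((1 + Num.sqrt 5) / 2) / ln 2 ->
  exists f : R -> set nat,
    (forall r, f r !=set0 /\ specification (gap_shift (f r)) /\
               has_entropy (gap_shift (f r)) q) /\
    (forall r s, r <> s -> gap_shift (f r) <> gap_shift (f s)).
Proof.
move=> /andP[q0 qphi].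
have ln20 : 0 < ln 2 :> R by rewrite ln_gt0 // ltr1n.
rewrite ltr_pdivlMr // in qphi.
(* This is [2^-q], so that [- ln x / ln 2 = q]. *)
pose x := expR (- (q * ln 2)).
have x0 : 0 < x by exact: expR_gt0.
have lnx : ln x = - (q * ln 2) by rewrite expRK.
have x1 : x < 1 by rewrite expR_lt1 oppr_lt0 mulr_gt0.
have hx : 1 < x + x ^+ 2 by apply: golden_ratio_bound => //; rewrite lnx opprK.
have [|c cE] := gap_set_encoding R x _ hx; first by rewrite x0.
have qE : - ln x / ln 2 = q by rewrite lnx opprK mulfK // gt_eqF.
rewrite qE in cE.
pose cut (r : R) : pred nat :=
  fun n => if unpickle n is Some p then ratr (p : rat) < r else false.
have [f fE] := choice (fun r => cE (cut r)).
exists f; split=> [r|r s rs /gap_shift_inj fE'].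
  by have [_ ? ? ?] := fE r.
apply: rs; apply: dedekind_cut_inj => n.
have [/(_ n) hr _ _ _] := fE r; have [/(_ n) hs _ _ _] := fE s.
by apply/idP/idP => [/hr|/hs]; [rewrite fE' => /hs|rewrite -fE' => /hr].
Qed.
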